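(* Let $n\ge-1$ be a real number with $n\neq0$. Let $\gamma_3:G_3\times I'_3\to I'_3$ be the action of $G_3$ on $I'_3$ given, for $g_1\in G_3$ with parameters $(q_1,r_1,t_1,x_1,s_1)$ and $f\in I'_3$, by $$(\gamma_3(g_1)\cdot f)(t,x)=r_1^{-1}q_1 f\left(\frac{t-t_1}{r_1^n q_1^2},\frac{x-x_1}{q_1}\right)+s_1.$$ Then $\gamma_3$ globalizes the local actions of the one-parameter groups generated by the basis elements $X_1,X_2,X_3,X_4,X_6$ of $\mathfrak{g}_3$ (with $X_i$ corresponding to $\xi_i\in\mathrm{Lie}(G_3)$, $i\in\{1,2,3,4,6\}$).
   Context: $\mathfrak{g}_3$ is the Lie algebra of vector fields on $\mathbb{R}^3$ (coordinates $t,x,v$) spanned by $$X_1=\frac{\partial}{\partial t},\quad X_2=\frac{\partial}{\partial x},\quad X_3=\frac{\partial}{\partial v},\quad X_4=2t\frac{\partial}{\partial t}+x\frac{\partial}{\partial x}+v\frac{\partial}{\partial v},\quad X_6=nt\frac{\partial}{\partial t}-v\frac{\partial}{\partial v};$$ it is the Lie point symmetry algebra of $v_t=(v_x)^n v_{xx}$. $G_3$ is the solvable Lie group of matrices $$\begin{pmatrix}r^n q^2 & 0 & 0 & t \\ 0 & q & 0 & x \\ 0 & 0 & q r^{-1}& s \\ 0& 0 & 0 & 1\end{pmatrix},\qquad q,r,s,t,x\in\mathbb{R},\ q,r>0;$$ such a matrix is said to have parameters $(q,r,t,x,s)$. $P_3\subset G_3$ is the subgroup of elements with $t=x=0$, and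 $\chi_3$ is the character of $P_3$ sending the element with parameters $(q,r,0,0,s)$ to $qr^{-1}$. $n_{t,x}$ is the element with parameters $(1,1,t,x,0)$. $I_3$ is the space of smooth real-valued $\varphi$ on $G_3$ with $\varphi(gp)=\chi_3(p)^{-1}\varphi(g)$ for all $g\in G_3,p\in P_3$, and $I'_3$ is the space of all $f\in C^\infty(\mathbb{R}^2)$ of the form $f(t,x)=\varphi(n_{t,x})$ with $\varphi\in I_3$ (in fact $I'_3=C^\infty(\mathbb{R}^2)$). With $E_{ij}$ the $4\times4$ matrix units, $\xi_1=E_{14}$, $\xi_2=E_{24}$, $\xi_3=E_{34}$, $\xi_4=\mathrm{diag}(2,1,1,0)$, $\xi_6=\mathrm{diag}(n,0,-1,0)$ in $\mathrm{Lie}(G_3)$. Local action of a vector field: if $X$ is a vector field on $\mathbb{R}^3$ with flow $\exp(\epsilon X)$ and $f$ is a smooth function on $\mathbb{R}^2$ with graph $\Gamma_f=\{(t,x,f(t,x))\}$, then $\exp(\epsilon X)\cdot f$ is the function whose graph is $\exp(\epsilon X)(\Gamma_f)$, whenever this is the graph of a function. An action $\gamma$ of a Lie group $G$ on a space of functions globalizes the local actions generated by vector fields $X_i$ (with $X_i$ corresponding to $\xi_i\in\mathrm{Lie}(G)$) if, for every $i$ and every $f$ in the space, $\gamma(\exp(\epsilon\xi_i))\cdot f=\exp(\epsilon X_i)\cdot f$ for all $\epsilon\in\mathbb{R}$ for which the right side is defined. *)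

(* Defs.v *)
From HB Require Import structures.
From mathcomp Require Import all_boot all_order all_algebra.
From mathcomp Require Import all_classical all_reals all_analysis.
Set Implicit Arguments.
Unset Strict Implicit.
Unset Printing Implicit Defensive.
Import Order.TTheory GRing.Theory Num.Theory.
Import numFieldNormedType.Exports.
Local Open Scope classical_set_scope.
Local Open Scope ring_scope.

Definition rvec (R : realType) (m : nat) (s : seq R) : 'rV[R]_m :=
  \row_(i < m) s`_i.

(* For [U] open, [Ck k U f] says that [f] has all iterated partial derivatives
   of order exactly [k] on [U] and that these are continuous on [U]; values
   outside [U] are irrelevant. *)
Fixpoint Ck (R : realType) (m k : nat) (U : set 'rV[R]_m.+1)
    (f : 'rV[R]_m.+1 -> R) : Prop :=
  if k is k'.+1 then
    forall i : 'I_m.+1,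
      (forall x, U x -> derivable f x (delta_mx 0 i)) /\
      Ck k' U (fun x => 'D_(delta_mx 0 i) f x)
  else forall x, U x -> {for x, continuous f}.

Definition smooth_on (R : realType) (m : nat) (U : set 'rV[R]_m.+1)
  (f : 'rV[R]_m.+1 -> R) : Prop := forall k, Ck k U f.

Definition mexp (R : realType) (m : nat) (A : 'M[R]_m.+1) : 'M[R]_m.+1 :=
  limn (series (fun k => (k`!%:R)^-1 *: A ^+ k)).

(* This is the Lie algebra when [G] is a Lie subgroup of GL_(m+1)(R). *)
Definition Lie (R : realType) (m : nat) (G : set 'M[R]_m.+1) :
  set 'M[R]_m.+1 := [set A | forall e : R, G (mexp (e *: A))].

(* [flow X e p p'] : the (possibly only local) flow of the vector field [X] at
   time [e] is defined at [p] and maps it to [p']. *)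
Definition flow (R : realType) (m : nat)
    (X : 'rV[R]_m.+1 -> 'rV[R]_m.+1) (e : R) (p p' : 'rV[R]_m.+1) : Prop :=
  exists (a b : R) (c : R -> 'rV[R]_m.+1),
    [/\ 0 \in `]a, b[, e \in `]a, b[, c 0 = p, c e = p' &
        forall s : R, s \in `]a, b[ -> is_derive s 1 c (X (c s))].

Definition graph (R : realType) (f : 'rV[R]_2 -> R) : set 'rV[R]_3 :=
  [set p | exists t x : R, p = rvec 3 [:: t; x; f (rvec 2 [:: t; x])]].

(* [local_action X e f h] : exp(e X).f is defined and equal to [h]. *)
Definition local_action (R : realType) (X : 'rV[R]_3 -> 'rV[R]_3) (e : R)
    (f h : 'rV[R]_2 -> R) : Prop :=
  [set p' | exists2 p, graph f p & flow X e p p'] = graph h.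

Definition is_action (R : realType) (m : nat) (G : set 'M[R]_m.+1)
    (T : Type) (S : set T) (act : 'M[R]_m.+1 -> T -> T) : Prop :=
  [/\ forall g f, G g -> S f -> S (act g f),
      forall f, S f -> act 1 f = f &
      forall g h f, G g -> G h -> S f -> act (g * h) f = act g (act h f)].

Definition globalizes (R : realType) (m : nat) (G : set 'M[R]_m.+1)
    (S : set ('rV[R]_2 -> R))
    (act : 'M[R]_m.+1 -> ('rV[R]_2 -> R) -> ('rV[R]_2 -> R))
    (I : Type) (X : I -> 'rV[R]_3 -> 'rV[R]_3) (xi : I -> 'M[R]_m.+1) : Prop :=
  [/\ is_action G S act,
      forall i, Lie G (xi i) &
      forall i f, S f -> forall (e : R) h, local_action (X i) e f h ->
        act (mexp (e *: xi i)) f = h].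

Definition G3mx (R : realType) (n q r t x s : R) : 'M[R]_4 :=
  \matrix_(i, j) nth 0 (nth [::]
    [:: [:: r `^ n * q ^+ 2; 0; 0;        t];
        [:: 0;               q; 0;        x];
        [:: 0;               0; q * r^-1; s];
        [:: 0;               0; 0;        1]] i) j.

Definition G3 (R : realType) (n : R) : set 'M[R]_4 :=
  [set g | exists q r t x s : R, [/\ 0 < q, 0 < r & g = G3mx n q r t x s]].

(* The parameters of an element of [G3 n], read off its entries. *)
Definition par_q (R : realType) (g : 'M[R]_4) : R := g 1 1.
Definition par_r (R : realType) (g : 'M[R]_4) : R := g 1 1 / g 2 2.
Definition par_t (R : realType) (g : 'M[R]_4) : R := g 0 3.
Definition par_x (R : realType) (g : 'M[R]_4) : R := g 1 3.
Definition par_s (R : realType) (g : 'M[R]_4) : R := g 2 3.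

Lemma par_G3mx (R : realType) (n q r t x s : R) (g := G3mx n q r t x s) :
  0 < q -> 0 < r ->
  [/\ par_q g = q, par_r g = r, par_t g = t, par_x g = x & par_s g = s].
Proof.
move=> q0 r0; rewrite /par_q /par_r /par_t /par_x /par_s /g /G3mx !mxE /=.
by split=> //; rewrite invfM invrK mulrA divff ?mul1r // gt_eqF.
Qed.

Definition P3 (R : realType) (n : R) : set 'M[R]_4 :=
  [set g | [/\ G3 n g, par_t g = 0 & par_x g = 0]].

Definition chi3 (R : realType) (p : 'M[R]_4) : R := par_q p * (par_r p)^-1.

(* A function on [G3 n] is represented by a function on all matrices, of which
   only the values on [G3 n] matter. Its smoothness is expressed in the global
   chart (q, r, t, x, s), which ranges over an open subset of R^5. *)
Definition smooth_G3 (R : realType) (n : R) (phi : 'M[R]_4 -> R) : Prop :=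
  smooth_on [set y : 'rV[R]_5 | 0 < y 0 0 /\ 0 < y 0 1]
    (fun y => phi (G3mx n (y 0 0) (y 0 1) (y 0 2) (y 0 3) (y 0 4))).

Definition I3 (R : realType) (n : R) : set ('M[R]_4 -> R) :=
  [set phi | smooth_G3 n phi /\
     forall g p, G3 n g -> P3 n p -> phi (g * p) = (chi3 p)^-1 * phi g].

Definition I3' (R : realType) (n : R) : set ('rV[R]_2 -> R) :=
  [set f | smooth_on setT f /\
     exists2 phi, I3 n phi &
       forall t x, f (rvec 2 [:: t; x]) = phi (G3mx n 1 1 t x 0)].

Definition gamma3 (R : realType) (n : R) (g : 'M[R]_4) (f : 'rV[R]_2 -> R) :
    'rV[R]_2 -> R :=
  fun y => (par_r g)^-1 * par_q g *
    f (rvec 2 [:: (y 0 0 - par_t g) / (par_r g `^ n * par_q g ^+ 2);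
                  (y 0 1 - par_x g) / par_q g])
    + par_s g.

Inductive g3_index := i1 | i2 | i3 | i4 | i6.

(* [X3 n i] is the vector field X_i in the coordinates (t, x, v) and [xi3 n i]
   the matrix xi_i. *)
Definition X3 (R : realType) (n : R) (i : g3_index) (y : 'rV[R]_3) :
    'rV[R]_3 :=
  let t := y 0 0 in let x := y 0 1 in let v := y 0 2 in
  match i with
  | i1 => rvec 3 [:: 1; 0; 0]
  | i2 => rvec 3 [:: 0; 1; 0]
  | i3 => rvec 3 [:: 0; 0; 1]
  | i4 => rvec 3 [:: 2 * t; x; v]
  | i6 => rvec 3 [:: n * t; 0; - v]
  end.

Definition xi3 (R : realType) (n : R) (i : g3_index) : 'M[R]_4 :=
  match i with
  | i1 => delta_mx 0 3
  | i2 => delta_mx 1 3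
  | i3 => delta_mx 2 3
  | i4 => diag_mx (rvec 4 [:: 2; 1; 1; 0])
  | i6 => diag_mx (rvec 4 [:: n; 0; -1; 0])
  end.

(* Main.v *)
Require Import Defs.
From HB Require Import structures.
From mathcomp Require Import all_boot all_order all_algebra.
From mathcomp Require Import all_classical all_reals all_analysis.
From mathcomp Require Import ring.
Import Order.TTheory GRing.Theory Num.Theory.
Import numFieldNormedType.Exports.
Local Open Scope classical_set_scope.
Local Open Scope ring_scope.

Set Implicit Arguments.
Unset Strict Implicit.
Unset Printing Implicit Defensive.

(** Let [G3 n] act on R^3 by letting a group element with parameters
    (q, r, t, x, s) send (a, b, v) to
    (r^n q^2 a + t, q b + x, q r^-1 v + s); this is [transform].  The formula
    defining [gamma3] says exactly that the graph of [gamma3 n g f] is the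
    image of the graph of [f] under [transform g] ([graph_gamma3]).  On the
    other hand every [X3 n i] is an affine vector field whose flow is complete
    and equal to [transform] along the one-parameter group of [xi3 n i]
    ([mexp_xi3], [flow_transform]).  So the graph of [gamma3 n (exp (e xi)) f]
    is contained in the image of the graph of [f] under the time-e flow; if
    that image is the graph of a function [h], two functions with nested graphs
    are equal ([graph_inj]) and [h] is [gamma3 n (exp (e xi)) f].

    It also has to be shown that [gamma3] acts on [I3' n].  The group law is
    a computation on parameters ([G3mxM]).  Stability rests on the fact that
    every smooth function on R^2 belongs to [I3' n] ([I3'_smooth]): an element
    with parameters (q, r, t, x, s) is the product of n_{t,x} and an element of
    [P3 n], so [f] extends equivariantly by (r / q) f(t, x).  The smoothness of
    that extension and of [gamma3 n g f] comes from a small calculus of smooth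
    functions, closed under partial derivatives ([elementary]). *)

(** * Smooth functions *)

Lemma Ck_eq_on (R : realType) (m k : nat) (U : set 'rV[R]_m.+1)
    (f g : 'rV[R]_m.+1 -> R) :
  open U -> (forall x, U x -> f x = g x) -> Ck k U f -> Ck k U g.
Proof.
move=> oU; elim: k f g => [|k IH] f g fg Ckf.
  move=> x Ux; have nfg : \forall y \near x, f y = g y.
    by apply: filterS (open_nbhs_nbhs (conj oU Ux)) => y; exact: fg.
  change (g @ x --> g x); rewrite -(fg _ Ux).
  exact: cvg_trans (near_eq_cvg nfg) (Ckf x Ux).
move=> i; have [dfi Ckdf] := Ckf i.
have nfg x : U x -> \forall y \near x, f y = g y.
  by move=> Ux; apply: filterS (open_nbhs_nbhs (conj oU Ux)) => y; exact: fg.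
split=> [x Ux|]; first exact: near_eq_derivable (nfg x Ux) (dfi x Ux).
by apply: IH Ckdf => x Ux; exact/near_eq_derive/nfg.
Qed.

(** Smoothness by coinduction: a family of continuous functions that is closed
    under partial differentiation (up to equality on the open set) consists of
    smooth functions.  Smoothness of products, inverses and composites is thus
    reduced to their first partial derivatives. *)
Lemma smooth_on_stable (R : realType) (m : nat) (U : set 'rV[R]_m.+1)
    (F : ('rV[R]_m.+1 -> R) -> Prop) :
  open U ->
  (forall f, F f -> forall x, U x -> {for x, continuous f}) ->
  (forall f, F f -> forall i, exists2 g, F g &
     forall x, U x -> is_derive x (delta_mx 0 i) f (g x)) ->
  forall f, F f -> smooth_on U f.
Proof.
move=> oU Fc Fd f Ff k; elim: k f Ff => [|k IH] f Ff; first exact: Fc.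
move=> i; have [g Fg dfg] := Fd f Ff i; split=> [x /dfg[]//|].
by apply: Ck_eq_on (IH g Fg) => // x /dfg[].
Qed.

(** A directional derivative only depends on the restriction to a line, which
    makes the one-variable chain rule available. *)
Lemma is_derive_slice (R : realType) (V : normedModType R) (f : V -> R)
    (x v : V) (d : R) :
  is_derive x v f d <-> is_derive (0 : R) 1 (fun h => f (h *: v + x)) d.
Proof.
have E : 'D_v f x = 'D_1 (fun h : R => f (h *: v + x)) 0.
  rewrite /derive; set g1 := fun h => h^-1 *: _; set g2 := fun h => h^-1 *: _.
  suff -> : g1 = g2 by [].
  by apply/funext => h; rewrite /g1 /g2 /= addr0 scale0r add0r [_%:A]mulr1.
split=> -[df <-]; split; rewrite ?E//.
- exact: (derivable1P f x v).1.
- exact: (derivable1P f x v).2.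
Qed.

(** Each variable of the source is felt by at most one variable of the target
    (possibly with [c = 0]), with a constant slope.  Then every partial derivative of
    [f \o A] is a multiple of one partial derivative of [f], by the one-variable
    chain rule. *)
Definition coordinatewise (R : realType) (m p : nat)
    (A : 'rV[R]_m.+1 -> 'rV[R]_p.+1) : Prop :=
  forall i, exists (j : 'I_p.+1) (c : R), forall h y,
    A (h *: delta_mx 0 i + y) = (c * h) *: delta_mx 0 j + A y.

Lemma is_derive_comp_coordinatewise (R : realType) (m p : nat)
    (A : 'rV[R]_m.+1 -> 'rV[R]_p.+1) (f : 'rV[R]_p.+1 -> R) i j (c d : R) y :
  (forall h y, A (h *: delta_mx 0 i + y) = (c * h) *: delta_mx 0 j + A y) ->
  is_derive (A y) (delta_mx 0 j) f d ->
  is_derive y (delta_mx 0 i) (f \o A) (c * d).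
Proof.
move=> AE /is_derive_slice df; apply/is_derive_slice.
set F := fun h : R => f (h *: delta_mx 0 j + A y) in df.
rewrite [X in is_derive _ _ X _](_ : _ = F \o ( *%R c)); last first.
  by apply/funext => h /=; rewrite AE.
have dc : is_derive (0 : R) 1 ( *%R c) c.
  by apply: is_derive_eq; rewrite [_ *: _]mulr1.
have df' : is_derive (c * 0) 1 F d by rewrite mulr0.
by have := is_derive1_comp df' dc; rewrite mulrC.
Qed.

(** The least class of functions containing what is needed below and closed
    under partial differentiation on [U].  It must be closed under sums,
    products and inverses because the Leibniz and quotient rules produce
    them. *)
Inductive elementary (R : realType) (m : nat) (U : set 'rV[R]_m.+1) :
    ('rV[R]_m.+1 -> R) -> Prop :=
| elem_cst c : elementary U (cst c)
| elem_coord i : elementary U (fun y => y 0 i)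
| elem_add f g : elementary U f -> elementary U g -> elementary U (f + g)
| elem_mul f g : elementary U f -> elementary U g -> elementary U (f * g)
| elem_inv f : elementary U f -> (forall y, U y -> f y != 0) ->
    elementary U (fun y => (f y)^-1)
| elem_comp p (A : 'rV[R]_m.+1 -> 'rV[R]_p.+1) f : continuous A ->
    coordinatewise A -> smooth_on setT f -> elementary U (f \o A).

Lemma elementary_continuous (R : realType) (m : nat) (U : set 'rV[R]_m.+1) f :
  elementary U f -> forall x, U x -> {for x, continuous f}.
Proof.
elim=> [c|i|f1 g1 _ IHf _ IHg|f1 g1 _ IHf _ IHg|f1 _ IHf f0|p A f1 cA _ sf] x Ux.
- exact: cst_continuous.
- exact: coord_continuous.
- by apply: continuousD; [exact: IHf|exact: IHg].
- by apply: continuousM; [exact: IHf|exact: IHg].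
- by apply: continuousV; [exact: f0|exact: IHf].
- by apply: continuous_comp; [exact: cA|exact: (sf 0%N)].
Qed.

Lemma elementary_derive (R : realType) (m : nat) (U : set 'rV[R]_m.+1) f :
  elementary U f -> forall i, exists2 g, elementary U g &
    forall x, U x -> is_derive x (delta_mx 0 i) f (g x).
Proof.
elim=> [c|j|f1 g1 ef IHf eg IHg|f1 g1 ef IHf eg IHg|f1 ef IHf f0
       |p A f1 cA sA sf] i.
- by exists (cst 0) => [|x _]; [exact: elem_cst|exact: is_derive_cst].
- exists (cst ((j == i)%:R)) => [|x _]; first exact: elem_cst.
  apply/is_derive_slice.
  have -> : (fun h : R => (h *: delta_mx 0 i + x) 0 j) =
      (fun h : R => (j == i)%:R * h + x 0 j).
    by apply/funext => h; rewrite !mxE mulrC eqxx.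
  by apply: is_derive_eq; rewrite [_ *: _]mulr1 addr0.
- have [df edf dfE] := IHf i; have [dg edg dgE] := IHg i.
  exists (df + dg); first exact: elem_add.
  by move=> x Ux; apply: is_deriveD; [exact: dfE|exact: dgE].
- have [df edf dfE] := IHf i; have [dg edg dgE] := IHg i.
  exists (f1 * dg + g1 * df); first by apply: elem_add; exact: elem_mul.
  by move=> x Ux; apply: is_deriveM; [exact: dfE|exact: dgE].
- have [df edf dfE] := IHf i; set f1V := fun y => (f1 y)^-1.
  have eV : elementary U f1V by exact: elem_inv.
  exists (cst (-1) * (f1V * f1V) * df).
    apply: elem_mul => //; apply: elem_mul; first exact: elem_cst.
    exact: elem_mul.
  move=> x Ux; have [dfx dE] := dfE x Ux.
  apply: DeriveDef; first exact: derivableV (f0 _ Ux) dfx.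
  rewrite deriveV ?f0// dE /f1V /= [_ *: _]/(_ * _) !fctE /=.
  by rewrite expr2 invfM mulN1r.
- have [j [c AE]] := sA i.
  exists (cst c * ((fun z => 'D_(delta_mx 0 j) f1 z) \o A)).
    apply: elem_mul; first exact: elem_cst.
    by apply: elem_comp => // k; have [] := sf k.+1 j.
  move=> x _; apply: is_derive_comp_coordinatewise AE _.
  by apply: derivableP; have [+ _] := sf 1%N j; exact.
Qed.

Lemma elementary_smooth (R : realType) (m : nat) (U : set 'rV[R]_m.+1) f :
  open U -> elementary U f -> smooth_on U f.
Proof.
move=> oU; apply: smooth_on_stable f => //.
- exact: elementary_continuous.
- exact: elementary_derive.
Qed.

Lemma cvg_mx (R : realType) (m n : nat) (T : Type) (F : set_system T)
    (FF : Filter F) (M : T -> 'M[R]_(m, n)) (L : 'M[R]_(m, n)) :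
  (forall i j, M x i j @[x --> F] --> L i j) -> M x @[x --> F] --> L.
Proof.
move=> cM; apply/cvgrPdist_le => /= e e0; near=> x.
rewrite /Num.Def.normr/= mx_normrE (bigmax_le _ (ltW e0))//= => i _.
rewrite !mxE/=; move: i; near: x; apply: filter_forall => /= i.
exact: (cvgrPdist_le _ _).1 (cM i.1 i.2) e e0.
Unshelve. all: by end_near. Qed.

Lemma continuous_mx (R : realType) (T : topologicalType) (m n : nat)
    (M : T -> 'M[R]_(m, n)) :
  (forall i j, continuous (fun x => M x i j)) -> continuous M.
Proof. by move=> cM x; apply: cvg_mx => i j; exact: cM. Qed.

(** The condition [i0 != i1] makes the affine map [coordinatewise]: otherwise
    moving one variable would move both arguments of [f]. *)
Lemma elem_affine2 (R : realType) (m : nat) (U : set 'rV[R]_m.+1)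
    (f : 'rV[R]_2 -> R) (i0 i1 : 'I_m.+1) (c0 c1 b0 b1 : R) :
  i0 != i1 -> smooth_on setT f ->
  elementary U
    (f \o fun y => rvec 2 [:: c0 * y 0 i0 + b0; c1 * y 0 i1 + b1]).
Proof.
move=> i01 sf; apply: elem_comp => //.
  have cA (c b : R) k : continuous (fun y : 'rV[R]_m.+1 => c * y 0 k + b).
    have e := elem_add (elem_mul (elem_cst setT c) (elem_coord setT k))
      (elem_cst setT b).
    by move=> y; exact: (elementary_continuous e).
  apply: continuous_mx => a [[|[|//]] hb].
  - rewrite [X in continuous X](_ : _ = fun y : 'rV_m.+1 => c0 * y 0 i0 + b0) //.
    by apply/funext => y; rewrite mxE.
  - rewrite [X in continuous X](_ : _ = fun y : 'rV_m.+1 => c1 * y 0 i1 + b1) //.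
    by apply/funext => y; rewrite mxE.
move=> i; have [->|ii0] := eqVneq i i0.
  exists 0, c0 => h y; apply/rowP => -[[|[|//]] hb]; rewrite !mxE ?eqxx /=.
  - by ring.
  - by rewrite eq_sym (negbTE i01) /=; ring.
have [->|ii1] := eqVneq i i1.
  exists 1, c1 => h y; apply/rowP => -[[|[|//]] hb]; rewrite !mxE ?eqxx /=.
  - by rewrite (negbTE i01) /=; ring.
  - by ring.
exists 0, 0 => h y; apply/rowP => -[[|[|//]] hb]; rewrite !mxE ?eqxx /=.
- by rewrite eq_sym (negbTE ii0) /=; ring.
- by rewrite eq_sym (negbTE ii1) /=; ring.
Qed.

(** * Curves of matrices and the matrix exponential *)

Lemma is_derive_mx (R : realType) (V : normedModType R) (m n : nat)
    (M : V -> 'M[R]_(m, n)) (t v : V) (D : 'M[R]_(m, n)) :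
  (forall i j, is_derive t v (fun x => M x i j) (D i j)) -> is_derive t v M D.
Proof.
move=> dM; have dv : derivable M t v by apply/derivable_mxP => i j; case: (dM i j).
apply: DeriveDef => //; rewrite derive_mx//; apply/matrixP => i j.
by rewrite mxE; case: (dM i j).
Qed.

Lemma mexp_diag (R : realType) (m : nat) (d : 'rV[R]_m.+1) :
  mexp (diag_mx d) = diag_mx (map_mx expR d).
Proof.
have dX k : diag_mx d ^+ k = diag_mx (map_mx (fun a => a ^+ k) d).
  elim: k => [|k IH].
    apply/matrixP => i j; rewrite expr0 !mxE; case: eqP => //.
  rewrite exprS IH; apply/matrixP => i j.
  rewrite -[_ * _]/(_ *m _) mul_diag_mx !mxE exprS.
  by case: eqP => // _; rewrite ?mulr1n // ?mulr0n mulr0.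
apply/cvg_lim => //.
apply: cvg_mx => i j.
rewrite [X in X @ _](_ : _ = fun k => (series (exp_coeff (d 0 i)) k) *+ (i == j)).
  rewrite !mxE; case: eqP => _ /=; last exact: cvg_cst.
  exact: is_cvg_series_exp_coeff.
apply/funext => k; rewrite /series /= summxE -sumrMnl; apply: eq_bigr => l _.
by rewrite !mxE dX !mxE /exp_coeff /= mulrnAr mulrC.
Qed.

Lemma mexp_sqr0 (R : realType) (m : nat) (A : 'M[R]_m.+1) :
  A ^+ 2 = 0 -> mexp A = 1 + A.
Proof.
move=> A2; apply: lim_near_cst => //; exists 2%N => //= k k2.
rewrite -(subnKC k2) /series /= !big_nat_recl// big1_seq => [|l _]; last first.
  by rewrite -[l.+2]/(2 + l)%N exprD A2 mul0r scaler0.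
by rewrite fact0 factS fact0 muln1 !invr1 !scale1r addr0 expr0 expr1.
Qed.

(** * The group and its action on functions *)

Section SymmetryGroup.
Variables (R : realType) (n : R).
Implicit Types (f : 'rV[R]_2 -> R) (i : g3_index).

Lemma powR_1l (a : R) : 1 `^ a = 1.
Proof. by rewrite powR1. Qed.

Lemma G3mx1 : G3mx n 1 1 0 0 0 = 1 :> 'M[R]_4.
Proof.
apply/matrixP => -[[|[|[|[|//]]]] ?] [[|[|[|[|//]]]] ?];
  by rewrite !mxE /= ?powR_1l ?expr1n ?invr1 ?mulr1.
Qed.

Lemma G3mxM (q r t x s q' r' t' x' s' : R) :
  0 < q -> 0 < r -> 0 < q' -> 0 < r' ->
  G3mx n q r t x s * G3mx n q' r' t' x' s' =
  G3mx n (q * q') (r * r') (r `^ n * q ^+ 2 * t' + t) (q * x' + x)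
    (q / r * s' + s).
Proof.
move=> q0 r0 q0' r0'.
apply/matrixP => -[[|[|[|[|//]]]] ?] [[|[|[|[|//]]]] ?];
  rewrite !mxE !big_ord_recl big_ord0 !mxE /=
   ?(mul0r, mulr0, add0r, addr0, mulr1)//.
- by rewrite powRM ?ltW//; ring.
- by rewrite invfM; ring.
Qed.

(** The equivariant extension of [f] is forced: [G3mx n q r t x s] is the
    product of [G3mx n 1 1 t x 0] and [G3mx n q r 0 0 s], at which
    [chi3] is [q / r]. *)
Lemma I3'_smooth f : smooth_on setT f -> I3' n f.
Proof.
move=> sf; split=> //.
exists (fun M => par_r M / par_q M * f (rvec 2 [:: par_t M; par_x M])).
  split.
    pose U := [set y : 'rV[R]_5 | 0 < y 0 0 /\ 0 < y 0 1].
    have oU : open U.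
      have -> : U = (fun y : 'rV[R]_5 => y 0 0) @^-1` [set u | 0 < u]
          `&` (fun y : 'rV[R]_5 => y 0 1) @^-1` [set u | 0 < u] by [].
      apply: openI; apply: open_comp => [y _|];
        by [exact: coord_continuous|exact: open_gt].
    (* The factors 1 and summands 0 give [A] the shape of [elem_affine2]. *)
    pose A (y : 'rV[R]_5) : 'rV[R]_2 := rvec 2 [:: 1 * y 0 2 + 0; 1 * y 0 3 + 0].
    pose F := (fun y : 'rV[R]_5 => y 0 1) * (fun y => (y 0 0)^-1) * (f \o A).
    have sF : smooth_on U F.
      apply: elementary_smooth => //; apply: elem_mul; first apply: elem_mul.
      - exact: elem_coord.
      - by apply: elem_inv => [|y [y0 _]]; [exact: elem_coord|exact: lt0r_neq0].
      - by apply: elem_affine2.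
    move=> k; apply: Ck_eq_on (sF k) => // y [y0 y1].
    have [-> -> -> -> _] := par_G3mx n (y 0 2) (y 0 3) (y 0 4) y0 y1.
    by rewrite /F !fctE /A /= !mul1r !addr0.
  move=> g p [q [r [t [x [s [q0 r0 ->]]]]]] [[q' [r' [t' [x' [s' [q0' r0' ->]]]]]]].
  rewrite /chi3.
  have [-> -> -> -> _] := par_G3mx n t' x' s' q0' r0' => -> ->.
  rewrite G3mxM//.
  have [-> -> -> -> _] := par_G3mx n t x s q0 r0.
  have [-> -> -> -> _] := par_G3mx n (r `^ n * q ^+ 2 * 0 + t) (q * 0 + x)
    (q / r * s' + s) (mulr_gt0 q0 q0') (mulr_gt0 r0 r0').
  rewrite !mulr0 !add0r; field.
  by rewrite !gt_eqF.
move=> t x.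
have [-> -> -> -> _] := par_G3mx n t x 0 (@ltr01 R) (@ltr01 R).
by rewrite divr1 mul1r.
Qed.

Lemma gamma3E (q r t x s : R) f y : 0 < q -> 0 < r ->
  gamma3 n (G3mx n q r t x s) f y =
  q / r * f (rvec 2 [:: (y 0 0 - t) / (r `^ n * q ^+ 2); (y 0 1 - x) / q]) + s.
Proof.
move=> q0 r0; rewrite /gamma3; have [-> -> -> -> ->] := par_G3mx n t x s q0 r0.
by rewrite (mulrC q).
Qed.

Lemma rvec2E (y : 'rV[R]_2) : rvec 2 [:: y 0 0; y 0 1] = y.
Proof.
by apply/rowP => -[[|[|//]] hb]; rewrite mxE /=; congr (y _ _); exact/val_inj.
Qed.

Lemma gamma3_smooth g f : G3 n g -> smooth_on setT f ->
  smooth_on setT (gamma3 n g f).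
Proof.
move=> [q [r [t [x [s [q0 r0 ->]]]]]] sf.
set c := r `^ n * q ^+ 2.
rewrite [gamma3 _ _ _](_ : _ = cst (q / r) * (f \o fun y : 'rV_2 =>
  rvec 2 [:: c^-1 * y 0 0 + - t / c; q^-1 * y 0 1 + - x / q]) + cst s).
  apply: elementary_smooth; first exact: openT.
  apply: elem_add; last exact: elem_cst.
  apply: elem_mul; first exact: elem_cst.
  exact: elem_affine2.
apply/funext => y; rewrite gamma3E//= !fctE /=.
by rewrite !mulrDl ![_^-1 * _]mulrC.
Qed.

Lemma gamma3_action : is_action (G3 n) (I3' n) (gamma3 n).
Proof.
split.
- by move=> g f Gg [sf _]; apply/I3'_smooth/gamma3_smooth.
- move=> f _; apply/funext => y; rewrite -G3mx1 gamma3E//.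
  rewrite powR_1l expr1n mulr1 !divr1 !subr0 mul1r addr0; congr f.
  exact: rvec2E.
- move=> _ h f [q [r [t [x [s [q0 r0 ->]]]]]].
  move=> [q' [r' [t' [x' [s' [q0' r0' ->]]]]]] _.
  apply/funext => y; rewrite G3mxM// !gamma3E ?mulr_gt0//.
  rewrite [rvec 2 _ 0 0]mxE [rvec 2 _ 0 1]mxE /=.
  rewrite powRM ?ltW//.
  have a0 := powR_gt0 n r0; have a0' := powR_gt0 n r0'.
  set F := f _; set F' := f _.
  have -> : F = F'.
    by rewrite /F /F'; congr (f (rvec 2 [:: _; _])); field; rewrite !gt_eqF.
  by field; rewrite !gt_eqF.
Qed.

(** * One-parameter groups and flows *)

Definition exp_xi3 i (e : R) : 'M[R]_4 :=
  match i with
  | i1 => G3mx n 1 1 e 0 0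
  | i2 => G3mx n 1 1 0 e 0
  | i3 => G3mx n 1 1 0 0 e
  | i4 => G3mx n (expR e) 1 0 0 0
  | i6 => G3mx n 1 (expR e) 0 0 0
  end.

Lemma exp_xi3_G3 i e : G3 n (exp_xi3 i e).
Proof.
case: i.
- by exists 1, 1, e, 0, 0.
- by exists 1, 1, 0, e, 0.
- by exists 1, 1, 0, 0, e.
- by exists (expR e), 1, 0, 0, 0; rewrite expR_gt0.
- by exists 1, (expR e), 0, 0, 0; rewrite expR_gt0.
Qed.

Lemma mexp_delta (k : 'I_4) (e : R) : k != 3 ->
  mexp (e *: delta_mx k 3) = 1 + e *: delta_mx k 3.
Proof.
move=> k3; apply: mexp_sqr0.
rewrite expr2 -[LHS]/(_ *m _) -scalemxAl -scalemxAr.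
by rewrite mul_delta_mx_0 ?scaler0 // eq_sym.
Qed.

Lemma mexp_xi3 i e : mexp (e *: xi3 n i) = exp_xi3 i e.
Proof.
case: i; rewrite /= ?mexp_delta// -?linearZ/= ?mexp_diag;
  apply/matrixP => -[[|[|[|[|//]]]] ?] [[|[|[|[|//]]]] ?]; rewrite !mxE /=
    ?powR_1l ?expr1n ?invr1 ?mulr1 ?mul1r ?mulr0 ?add0r ?addr0 ?expR0 //.
- by rewrite mulr1n expRM_natr.
- by rewrite mulr1n expRM.
- by rewrite mulr1n mulrN1 expRN.
Qed.

Lemma ord3P (l : 'I_3) : [\/ l = 0, l = 1 | l = 2].
Proof.
by case: l => -[|[|[|//]]] hl; [apply: Or31|apply: Or32|apply: Or33];
  exact/val_inj.
Qed.

(** The action of a matrix of [G3 n] on the affine hyperplane of column vectors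
    (t, x, v, 1). *)
Definition transform (g : 'M[R]_4) (p : 'rV[R]_3) : 'rV[R]_3 :=
  rvec 3 [:: g 0 0 * p 0 0 + g 0 3; g 1 1 * p 0 1 + g 1 3;
             g 2 2 * p 0 2 + g 2 3].

(** The arguments of [f] in [gamma3 n g f] are the inverse images of t and x
    under [transform g]. *)
Lemma graph_gamma3 g f :
  G3 n g -> graph (gamma3 n g f) `<=` transform g @` graph f.
Proof.
move=> [q [r [t0 [x0 [s [q0 r0 ->]]]]]] _ [t [x ->]].
have a0 := powR_gt0 n r0.
pose t' := (t - t0) / (r `^ n * q ^+ 2); pose x' := (x - x0) / q.
exists (rvec 3 [:: t'; x'; f (rvec 2 [:: t'; x'])]); first by exists t', x'.
rewrite gamma3E// [rvec 2 _ 0 0]mxE [rvec 2 _ 0 1]mxE /=.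
rewrite -/t' -/x'; apply/rowP => -[[|[|[|//]]] hb]; rewrite !mxE //=.
- by rewrite /t'; field; rewrite !gt_eqF.
- by rewrite /x'; field; rewrite !gt_eqF.
Qed.

(** The five vector fields are decoupled: each coordinate y satisfies an
    equation y' = w y + b with w the [rate] and b the [drift], at least one
    of which vanishes.  This lets a single computation treat all the flows. *)
Definition rate i : 'rV[R]_3 :=
  match i with
  | i4 => rvec 3 [:: 2; 1; 1]
  | i6 => rvec 3 [:: n; 0; -1]
  | _ => 0
  end.

Definition drift i : 'rV[R]_3 :=
  match i with
  | i1 => rvec 3 [:: 1; 0; 0]
  | i2 => rvec 3 [:: 0; 1; 0]
  | i3 => rvec 3 [:: 0; 0; 1]
  | _ => 0
  end.

Lemma X3E i y k l : X3 n i y k l = rate i 0 l * y 0 l + drift i 0 l.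
Proof.
by case: i; have [->|->|->] := ord3P l; rewrite /X3 !mxE /=
  ?(mul0r, mul1r, mulN1r, add0r, addr0).
Qed.

Lemma transform_exp_xi3E i s p k l : transform (exp_xi3 i s) p k l =
  expR (s * rate i 0 l) * p 0 l + s * drift i 0 l.
Proof.
by case: i; have [->|->|->] := ord3P l; rewrite /transform !mxE /=
  ?powR_1l ?expr1n ?invr1 ?(mulr0, mul0r, mulr1, addr0, expR0) ?mul1r
  ?mulrN1 ?expRN ?expRM_natr ?expRM.
Qed.

Lemma transform_exp_xi3_flow i p (e : R) :
  is_derive e 1 (fun s => transform (exp_xi3 i s) p)
    (X3 n i (transform (exp_xi3 i e) p)).
Proof.
apply: is_derive_mx => k l; rewrite X3E transform_exp_xi3E.
under eq_fun do rewrite transform_exp_xi3E.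
have rd : rate i 0 l * drift i 0 l = 0.
  by case: i; have [->|->|->] := ord3P l; rewrite !mxE /= ?(mulr0, mul0r).
set w := rate i 0 l in rd *; set b := drift i 0 l in rd *.
have dE : is_derive e 1 (fun s : R => expR (s * w)) (w * expR (e * w)).
  have dw : is_derive e 1 (fun s : R => s * w) w.
    rewrite [X in is_derive _ _ X](_ : _ = *%R w); last first.
      by apply/funext => s; rewrite mulrC.
    by apply: is_derive_eq; rewrite [_ *: _]mulr1.
  rewrite mulrC.
  exact: (is_derive1_comp (g := *%R^~ w) (is_derive_expR (e * w)) dw).
(* Since w b = 0, the derivative w exp(e w) p + b is w times the value of the
   curve at e, plus b. *)
have dF : is_derive e 1 ((fun s : R => expR (s * w)) * cst (p 0 l) + id * cst b)
    (w * (expR (e * w) * p 0 l + e * b) + b).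
  apply: is_derive_eq; rewrite /cst !scaler0 !add0r.
  rewrite -[LHS]/(p 0 l * (w * expR (e * w)) + b * 1).
  by rewrite mulrDr (mulrCA w e) rd; ring.
exact: dF.
Qed.

Lemma graph_inj f h : graph f `<=` graph h -> f = h.
Proof.
move=> fh; apply/funext => y; rewrite -(rvec2E y).
have [|t [x E]] := fh (rvec 3 [:: y 0 0; y 0 1; f (rvec 2 [:: y 0 0; y 0 1])]).
  by exists (y 0 0), (y 0 1).
have /= := congr1 (fun z : 'rV_3 => z 0 0) E; rewrite !mxE /= => Et.
have /= := congr1 (fun z : 'rV_3 => z 0 1) E; rewrite !mxE /= => Ex.
by have /= := congr1 (fun z : 'rV_3 => z 0 2) E; rewrite !mxE /= Et Ex.
Qed.

Lemma exp_xi30 i : exp_xi3 i 0 = 1.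
Proof. by case: i; rewrite /= ?expR0 G3mx1. Qed.

(** The integral curves are defined on the whole line; the interval is only
    chosen to contain 0 and [e]. *)
Lemma flow_transform i e p : flow (X3 n i) e p (transform (exp_xi3 i e) p).
Proof.
exists (- (`|e| + 1)), (`|e| + 1), (fun s => transform (exp_xi3 i s) p).
have e1 : `|e| < `|e| + 1 by rewrite ltrDl.
split=> //.
- by rewrite in_itv /= oppr_lt0 ltr_wpDl.
- by rewrite in_itv /= -ltr_norml.
- apply/rowP => l; have [->|->|->] := ord3P l;
    by rewrite exp_xi30 !mxE /= mul1r addr0.
- by move=> s _; exact: transform_exp_xi3_flow.
Qed.

End SymmetryGroup.

Theorem proposition5 (R : realType) (n : R) (hn : -1 <= n) (hn0 : n != 0) :
  globalizes (G3 n) (I3' n) (gamma3 n) (X3 n) (xi3 n).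
Proof.
split.
- exact: gamma3_action.
- by move=> i e; rewrite mexp_xi3; exact: exp_xi3_G3.
- move=> i f _ e h fh; rewrite mexp_xi3; apply: graph_inj.
  rewrite -fh => _ /(graph_gamma3 (exp_xi3_G3 n i e))[p fp <-].
  by exists p => //; exact: flow_transform.
Qed.
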